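(* Let $f\in\mathbb{C}[x_1,\dots,x_n]$ be a non-zero polynomial with $f(0)=0$. Assume that $f$ is non-degenerate at the origin $0\in\mathbb{C}^n$. Then, except for finitely many $c\in\mathbb{C}$, the polynomial $f_c(x)=f(x_1,x_2,\dots,x_{n-1},x_n+c)$ is non-degenerate at the origin $0\in\mathbb{C}^n$.
   Context: For a non-zero $g=\sum_{v\in\mathbb{Z}_+^n}c_vx^v\in\mathbb{C}[x_1,\dots,x_n]$ (where $\mathbb{Z}_+=\{m\in\mathbb{Z}:m\ge0\}$), the Newton polyhedron $\Gamma_+(g)$ is the convex hull of $\bigcup_{v:\,c_v\ne0}(v+\mathbb{R}_+^n)$, $\mathbb{R}_+=[0,\infty)$. The polynomial $g$ is non-degenerate at the origin if for every compact face $\tau$ of $\Gamma_+(g)$ the hypersurface $\{x\in(\mathbb{C}^* )^n: g_\tau(x)=0\}$ is smooth (i.e. $g_\tau$ and all its partial derivatives have no common zero in $(\mathbb{C}^* )^n$), where $g_\tau=\sum_{v\in\tau\cap\mathbb{Z}_+^n}c_vx^v$. *)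

(* Defs.v *)
From HB Require Import structures.
From mathcomp Require Import all_boot all_order all_algebra.
(* mpoly must be imported before normedtype: their notations at level 2 clash
   in the other order. *)
From mathcomp Require Import mpoly.
From mathcomp Require Import complex boolp classical_sets cardinality reals.
From mathcomp Require Import topology normedtype convex.

Set Implicit Arguments.
Unset Strict Implicit.
Unset Printing Implicit Defensive.

Import Order.TTheory GRing.Theory Num.Theory.
Import numFieldNormedType.Exports.

Local Open Scope classical_set_scope.
Local Open Scope ring_scope.

Definition convex_hull (R : numDomainType) (M : lmodType R) (A : set M) :
    set M :=
  smallest (@convex_set R M) A.

Section Newton.
Variables (R : realType) (n : nat).
Implicit Types (g : {mpoly R[i][n]}) (P tau : set 'rV[R]_n).

Definition mnm_point (v : 'X_{1..n}) : 'rV[R]_n := \row_i (v i)%:R.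

Definition orthant : set 'rV[R]_n := [set y | forall i, 0 <= y 0 i].

Definition newton_polyhedron g : set 'rV[R]_n :=
  convex_hull (\bigcup_(v in [set v | g@_v != 0])
                 [set mnm_point v + y | y in orthant]).

Definition dot (l x : 'rV[R]_n) : R := \sum_i l 0 i * x 0 i.

(* Faces of a polyhedron: the loci where a linear form attains its minimum.
   The form 0 gives P itself; the empty set is not a face (it would make every
   polynomial degenerate, since g_tau = 0 for empty tau). *)
Definition is_face P tau : Prop :=
  tau !=set0 /\
  exists l : 'rV[R]_n,
    tau = [set x | P x /\ forall y, P y -> dot l x <= dot l y].

Definition face_poly g tau : {mpoly R[i][n]} :=
  \sum_(v <- msupp g | mnm_point v \in tau) g@_v *: 'X_[v].

Definition smooth_on_torus g : Prop :=
  forall x : 'I_n -> R[i], (forall i, x i != 0) ->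
    ~ (g.@[x] = 0 /\ forall i : 'I_n, (g^`M(i)).@[x] = 0).

Definition newton_nondegenerate g : Prop :=
  forall tau, is_face (newton_polyhedron g) tau -> compact tau ->
    smooth_on_torus (face_poly g tau).

End Newton.

Definition shift_last (R : realType) (n : nat) (c : R[i])
    (f : {mpoly R[i][n.+1]}) : {mpoly R[i][n.+1]} :=
  f \mPo [tuple (if i == ord_max then 'X_i + c%:MP else 'X_i) | i < n.+1].

(* Main.v *)
Require Import Defs.
From HB Require Import structures.
From mathcomp Require Import all_boot all_order all_algebra.
From mathcomp Require Import mpoly.
From mathcomp Require Import complex boolp classical_sets cardinality reals.
From mathcomp Require Import topology normedtype convex.
From mathcomp Require Import sequences realfun exp closed_field.
From mathcomp Require Import ring lra interval_inference.

(* Let [q_w] be the coefficient in [C[x_n]] of a monomial [w] in the other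
   variables.  If no nonzero [q_w] vanishes at [c], a compact face of the Newton
   polyhedron of [f_c] lies in [x_n = 0], and its polynomial is the restriction
   to [x_n = c] of the part [f_S] of [f] supported on the exponents that minimize
   a weight [l] with [l_n = 0] and [l_i > 0] for [i < n].  There are finitely many
   such [S], so fix one and let [B] be the set of the [c] for which this
   restriction has a singular zero in the torus.  By quantifier elimination [B]
   is finite or cofinite.  If it is cofinite, choose [c_k -> 0] in [B] with
   singular zeros [x_k].  A tropical limit along an ultrafilter produces a weight
   [l'] with [l'_n > 0] and a torus point [a] at which the [l']-initial part of
   [f_S] is singular: write [ln |x_k| = l_k + w_k] where [l_k] is constant on the
   exponents of the dominant monomials and [w_k] converges; then [l' = - l_k] for
   a suitable [k], and [a = lim x_k exp(- l_k)].  For large [N] the weight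
   [l' + N l] is positive and selects that initial part as a compact face of [f],
   against non-degeneracy; the derivative in [x_n], which the restrictions do not
   control, vanishes by Euler's relation. *)

Set Implicit Arguments.
Unset Strict Implicit.
Unset Printing Implicit Defensive.

Import Order.TTheory GRing.Theory Num.Theory.
Import numFieldNormedType.Exports.

Local Open Scope classical_set_scope.
Local Open Scope ring_scope.

(** * Definable subsets of an algebraically closed field *)

Lemma finite_roots (F : closedFieldType) (p : {poly F}) :
  p != 0 -> finite_set [set c | p.[c] = 0].
Proof.
move=> p0; have [r Er] := closed_field_poly_normal p.
apply: (@sub_finite_set _ _ [set` r]); last exact: finite_seq.
move=> c /= pc; rewrite -root_prod_XsubC.
have : root p c by apply/rootP.
by rewrite Er rootZ // lead_coef_eq0.
Qed.

(** The environment [set_nth 0 [::] m c] gives variable [m] the value [c] and every other variable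
    the default 0, so an inverse-free term becomes a polynomial in [c]. *)
Lemma eval_poly_term (F : closedFieldType) (m : nat) (t : GRing.term F) :
  GRing.rterm t ->
  exists p : {poly F}, forall c, GRing.eval (set_nth 0 [::] m c) t = p.[c].
Proof.
elim: t => //=.
- move=> i _; exists (if i == m then 'X else 0) => c.
  by rewrite nth_set_nth /=; case: eqP; rewrite ?hornerX ?nth_nil ?horner0.
- by move=> a _; exists a%:P => c; rewrite hornerC.
- by move=> k _; exists k%:R => c; rewrite -polyC_natr hornerC.
- move=> t1 IH1 t2 IH2 /andP[/IH1[p1 E1] /IH2[p2 E2]].
  by exists (p1 + p2) => c; rewrite E1 E2 hornerD.
- by move=> t1 IH1 /IH1[p1 E1]; exists (- p1) => c; rewrite E1 hornerN.
- by move=> t1 IH1 k /IH1[p1 E1]; exists (p1 *+ k) => c; rewrite E1 hornerMn.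
- move=> t1 IH1 t2 IH2 /andP[/IH1[p1 E1] /IH2[p2 E2]].
  by exists (p1 * p2) => c; rewrite E1 E2 hornerM.
- by move=> t1 IH1 k /IH1[p1 E1]; exists (p1 ^+ k) => c; rewrite E1 horner_exp.
Qed.

Definition finite_or_cofinite (T : Type) (A : set T) :=
  finite_set A \/ finite_set (~` A).

Lemma finite_or_cofiniteC (T : Type) (A : set T) :
  finite_or_cofinite A -> finite_or_cofinite (~` A).
Proof. by case=> ?; [right; rewrite setCK | left]. Qed.

Lemma finite_or_cofiniteI (T : Type) (A B : set T) :
  finite_or_cofinite A -> finite_or_cofinite B -> finite_or_cofinite (A `&` B).
Proof.
move=> [fA|cA]; first by move=> _; left; exact/finite_setIl.
move=> [fB|cB]; first by left; exact/finite_setIr.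
by right; rewrite setCI finite_setU.
Qed.

Lemma finite_or_cofiniteU (T : Type) (A B : set T) :
  finite_or_cofinite A -> finite_or_cofinite B -> finite_or_cofinite (A `|` B).
Proof.
move=> hA hB; rewrite -[A]setCK -[B]setCK -setCI.
by apply/finite_or_cofiniteC/finite_or_cofiniteI; apply: finite_or_cofiniteC.
Qed.

(** An atomic equation defines the roots of [p1 - p2], a finite set unless the two polynomials
    agree; the connectives preserve the class. *)
Lemma qf_eval_finite_or_cofinite (F : closedFieldType) (m : nat)
    (f : GRing.formula F) : GRing.qf_form f -> GRing.rformula f ->
  finite_or_cofinite [set c | GRing.qf_eval (set_nth 0 [::] m c) f].
Proof.
elim: f => //=.
- move=> [] _ _; first by right; apply: (@sub_finite_set _ _ set0) => // x /=.
  by left; apply: (@sub_finite_set _ _ set0) => // x /=.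
- move=> t1 t2 _ /andP[/(eval_poly_term m)[p1 E1] /(eval_poly_term m)[p2 E2]].
  have [p12|p12] := eqVneq p1 p2.
    by right; apply: (@sub_finite_set _ _ set0) => // c /=; rewrite E1 E2 p12.
  left; apply: (@sub_finite_set _ _ [set c | (p1 - p2).[c] = 0]).
    by move=> c /= /eqP; rewrite E1 E2 hornerD hornerN => ->; rewrite subrr.
  by apply: finite_roots; rewrite subr_eq0.
- move=> f1 IH1 f2 IH2 /andP[q1 q2] /andP[r1 r2].
  apply: eq_ind (finite_or_cofiniteI (IH1 q1 r1) (IH2 q2 r2)) _ _.
  by apply/seteqP; split=> c /= /andP.
- move=> f1 IH1 f2 IH2 /andP[q1 q2] /andP[r1 r2].
  apply: eq_ind (finite_or_cofiniteU (IH1 q1 r1) (IH2 q2 r2)) _ _.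
  by apply/seteqP; split=> c /= /orP.
- move=> f1 IH1 f2 IH2 /andP[q1 q2] /andP[r1 r2].
  apply: eq_ind (finite_or_cofiniteU (finite_or_cofiniteC (IH1 q1 r1)) (IH2 q2 r2)) _ _.
  apply/seteqP; split=> c /=; rewrite implybE.
    by case=> [/negP -> | ->]; rewrite ?orbT.
  by case/orP=> [/negP|]; auto.
- move=> f1 IH1 q1 r1.
  apply: eq_ind (finite_or_cofiniteC (IH1 q1 r1)) _ _.
  by apply/seteqP; split=> c /= /negP.
Qed.

(** Strong minimality of algebraically closed fields. Quantifiers are eliminated from inverse-free
    formulas, hence the passage through [to_rform]. *)
Lemma definable_finite_or_cofinite (F : closedFieldType) (m : nat)
    (f : GRing.formula F) :
  finite_or_cofinite [set c | GRing.holds (set_nth 0 [::] m c) f].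
Proof.
have wf := @ClosedFieldQE.wf_ex_elim F.
have ok := ClosedFieldQE.holds_ex_elim (@solve_monicpoly F).
have rf := GRing.to_rform_rformula f.
have /andP[q r] := GRing.quantifier_elim_wf wf rf.
apply: eq_ind (qf_eval_finite_or_cofinite m q r) _ _.
apply/seteqP; split=> c /=.
  by move=> /(GRing.quantifier_elim_rformP wf ok _ rf) /GRing.to_rformP.
by move=> /GRing.to_rformP /(GRing.quantifier_elim_rformP wf ok _ rf).
Qed.

(** The set is the projection of a constructible set to the last coordinate, so a first-order
    formula with one free variable defines it. *)
Lemma torus_system_finite_or_cofinite (F : closedFieldType) (n : nat)
    (ps : seq {mpoly F[n.+1]}) :
  finite_or_cofinite [set c | exists x : 'I_n.+1 -> F,
    [/\ forall i, x i != 0, x ord_max = c &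
        forall p, p \in ps -> p.@[x] = 0]].
Proof.
pose tm (v : 'X_{1..n.+1}) : GRing.term F :=
  \big[GRing.Mul/GRing.Const 1]_(i < n.+1) GRing.Exp (GRing.Var F i) (v i).
pose tp (p : {mpoly F[n.+1]}) : GRing.term F :=
  \big[GRing.Add/GRing.Const 0]_(v <- msupp p) GRing.Mul (GRing.Const p@_v) (tm v).
pose nz : GRing.formula F :=
  \big[GRing.And/GRing.Bool true]_(i < n.+1)
    GRing.Not (GRing.Equal (GRing.Var F i) (GRing.Const 0)).
pose zs : GRing.formula F :=
  \big[GRing.And/GRing.Bool true]_(p <- ps) GRing.Equal (tp p) (GRing.Const 0).
have tpE e p : GRing.eval e (tp p) = p.@[fun i : 'I_n.+1 => e`_i].
  rewrite mevalE /tp (big_morph (GRing.eval e) (id1 := 0) (op1 := +%R)) //=.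
  apply: eq_bigr => v _ /=; congr (_ * _).
  by rewrite /tm (big_morph (GRing.eval e) (id1 := 1) (op1 := *%R)).
have nzP e : GRing.holds e nz <-> forall i : 'I_n.+1, e`_i != 0.
  rewrite /nz; have -> : (forall i : 'I_n.+1, e`_i != 0) <->
      (forall i : 'I_n.+1, i \in index_enum 'I_n.+1 -> e`_i != 0).
    by split=> // h i; apply: h; rewrite mem_index_enum.
  elim: (index_enum _) => [|i s IH]; first by rewrite big_nil.
  rewrite big_cons /= IH; split=> [[/eqP i0 h] j|h].
    by rewrite inE => /predU1P[->|/h].
  split; first by apply/eqP/h; rewrite mem_head.
  by move=> j js; apply: h; rewrite inE js orbT.
have zsP e : GRing.holds e zs <->
    forall p, p \in ps -> p.@[fun i : 'I_n.+1 => e`_i] = 0.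
  rewrite /zs; elim: (ps) => [|p s IH]; first by rewrite big_nil.
  rewrite big_cons /= tpE IH; split=> [[p0 h] q|h].
    by rewrite inE => /predU1P[->|/h].
  split; first by apply/h; rewrite mem_head.
  by move=> j js; apply: h; rewrite inE js orbT.
(* Variables 0 to [n - 1] are bound; variable [n], the index of [ord_max], stays free and receives
   [c]. *)
pose f := foldr GRing.Exists (GRing.And nz zs) (iota 0 n).
apply: eq_ind (definable_finite_or_cofinite n f) _ _.
apply/seteqP; split=> c /=.
  move=> /GRing.foldExistsP[e eE /= [/nzP nz_e /zsP zs_e]].
  exists (fun i => e`_i); split=> //.
  by rewrite -eE ?nth_set_nth /= ?eqxx // !inE mem_iota ltnn andbF.
case=> x [x0 xc xps]; apply/GRing.foldExistsP.
(* The environment must agree with [set_nth 0 [::] n c] off the bound indices: entry [n] is [c], and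
   later entries default to 0. *)
exists (mkseq (fun i => x (inord i)) n.+1).
  move=> i; rewrite !inE mem_iota add0n /= -leqNgt => ni.
  rewrite nth_set_nth /=; case: eqP => [->|/eqP in'].
    rewrite nth_mkseq // -xc; congr x; apply: val_inj.
    by rewrite /= inordK.
  by rewrite nth_nil nth_default // size_mkseq ltn_neqAle eq_sym in'.
have xE (i : 'I_n.+1) : (mkseq (fun i => x (inord i)) n.+1)`_i = x i.
  by rewrite nth_mkseq // inord_val.
split; first by apply/nzP => i; rewrite xE.
apply/zsP => p /xps; rewrite (_ : (fun i : 'I_n.+1 => _) = x) //.
by apply/funext => i; exact: xE.
Qed.

(** * Limits along an ultrafilter *)

Lemma near_all_seq (K : Type) (F : set_system K) (T : eqType) (s : seq T)
    (P : T -> K -> Prop) : Filter F ->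
  (forall u, u \in s -> \forall k \near F, P u k) ->
  \forall k \near F, forall u, u \in s -> P u k.
Proof.
move=> FF; elim: s => [|v s IH] h; first by apply: filterE => k u; rewrite in_nil.
have h1 := h v (mem_head v s).
have h2 : \forall k \near F, forall u, u \in s -> P u k.
  by apply: IH => u us; apply: h; rewrite inE us orbT.
apply: filterS2 h1 h2 => k vk sk u; rewrite inE.
by case/predU1P=> [->|/sk].
Qed.

Section UltraLimits.
Variables (K : Type) (F : set_system K).
Context {FU : UltraFilter F}.

Lemma ultra_fmap (T : Type) (g : K -> T) : UltraFilter (g @ F).
Proof.
split; first exact: fmap_proper_filter.
move=> G GF sFG; apply/seteqP; split=> // A GA.
have [//|FnA] := in_ultra_setVsetC (g @^-1` A) FU.
have /filter_ex[t []//] : G (A `&` ~` A).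
by apply: filterI => //; apply: sFG.
Qed.

Lemma ultra_bounded_cvg (R : realType) (g : K -> R) (M : R) :
  (\forall k \near F, `|g k| <= M) -> exists l : R, g k @[k --> F] --> l.
Proof.
move=> gM; have := @segment_compact R (- M) M; rewrite compact_ultra.
case/(_ (g @ F) (ultra_fmap g)).
  by apply: filterS gM => k; rewrite ler_norml /= in_itv.
by move=> l [_ gl]; exists l.
Qed.

(** An ultrafilter decides each comparison, so one fixed index dominates; along a general filter the
    maximizer could keep changing with [k]. *)
Lemma ultra_argmax (R : realType) (T : eqType) (s : seq T) (e : T -> K -> R) :
  s != [::] -> exists2 u0, u0 \in s &
    \forall k \near F, forall u, u \in s -> e u k <= e u0 k.
Proof.
case: s => // v s _; elim: s v => [|v' s IH] v.
  by exists v; [exact: mem_head | apply: filterE => k u; rewrite inE => /eqP ->].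
have [u0 u0s u0max] := IH v'.
have [vle|vgt] := in_ultra_setVsetC [set k | e v k <= e u0 k] FU.
  exists u0; first by rewrite inE u0s orbT.
  apply: filterS2 vle u0max => k /= vk uk u; rewrite inE.
  by case/predU1P=> [->|/uk].
exists v; first exact: mem_head.
apply: filterS2 vgt u0max => k /= /negP; rewrite -ltNge => vk uk u; rewrite inE.
by case/predU1P=> [->//|/uk /le_trans]; apply; exact: ltW.
Qed.

End UltraLimits.

Lemma normc_gt0 (R : realType) (z : R[i]) : z != 0 -> 0 < ComplexField.Normc.normc z.
Proof.
move=> z0; rewrite lt_def; apply/andP; split; last by case: z {z0} => a b; exact: sqrtr_ge0.
by apply: contra_neq z0 => /ComplexField.Normc.eq0_normc.
Qed.

Lemma normc_real (R : realType) (a : R) : ComplexField.Normc.normc a%:C%C = `|a|.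
Proof. by rewrite /= expr0n /= addr0 sqrtr_sqr. Qed.

Lemma cvg_sumr (R : realType) (K : Type) (F : set_system K) (I : Type)
    (r : seq I) (g : I -> K -> R) (a : I -> R) : Filter F ->
  (forall i, g i k @[k --> F] --> a i) ->
  (\sum_(i <- r) g i k) @[k --> F] --> \sum_(i <- r) a i.
Proof.
move=> FF ga; elim: r => [|i r IH].
  by rewrite big_nil (_ : (fun k => _) = fun=> 0);
    [exact: cvg_cst | apply/funext => k; rewrite big_nil].
rewrite big_cons (_ : (fun k => _) = fun k => g i k + \sum_(j <- r) g j k).
  exact: cvgD.
by apply/funext => k; rewrite big_cons.
Qed.

Lemma cvg_rV (R : realType) (K : Type) (F : set_system K) n
    (g : K -> 'rV[R]_n) (a : 'rV[R]_n) : Filter F ->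
  (forall i, g k 0 i @[k --> F] --> a 0 i) -> g k @[k --> F] --> a.
Proof.
move=> FF ga; apply/cvg_ballP => e e0.
have : \forall k \near F, forall i, i \in index_enum 'I_n -> ball (a 0 i) e (g k 0 i).
  by apply: near_all_seq => i _; move/cvg_ballP: (ga i); apply.
by apply: filterS => k h; split=> // i j; rewrite (ord1 i); apply: h; rewrite mem_index_enum.
Qed.

(* Convergence in [R[i]] is componentwise, to inherit compactness from [R]. *)
Section ComplexLimits.
Variables (R : realType) (K : Type) (F : set_system K).
Context {FF : ProperFilter F}.
Implicit Types (z : K -> R[i]) (l : R[i]).

Definition ccvg z l :=
  (complex.Re (z k) @[k --> F] --> complex.Re l) /\
  (complex.Im (z k) @[k --> F] --> complex.Im l).

Lemma ccvg_unique z l l' : ccvg z l -> ccvg z l' -> l = l'.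
Proof.
move=> [h1 h2] [h1' h2']; have := cvg_unique _ h1 h1'; have := cvg_unique _ h2 h2'.
by case: l l' {h1 h2 h1' h2'} => [a b] [c d] /= -> // ->.
Qed.

Lemma ccvg_cst l : ccvg (fun=> l) l.
Proof. by split; apply: cvg_cst. Qed.

Lemma ccvg_real (g : K -> R) (l : R) :
  g k @[k --> F] --> l -> ccvg (fun k => (g k)%:C%C) l%:C%C.
Proof. by move=> gl; split=> //=; apply: cvg_cst. Qed.

Lemma ccvgD z z' l l' : ccvg z l -> ccvg z' l' ->
  ccvg (fun k => z k + z' k) (l + l').
Proof.
have ReD (a b : R[i]) : complex.Re (a + b) = complex.Re a + complex.Re b.
  by case: a b => [? ?] [].
have ImD (a b : R[i]) : complex.Im (a + b) = complex.Im a + complex.Im b.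
  by case: a b => [? ?] [].
move=> [h1 h2] [h1' h2']; split; rewrite ?ReD ?ImD.
  by under eq_fun do rewrite ReD; apply: cvgD.
by under eq_fun do rewrite ImD; apply: cvgD.
Qed.

Lemma ccvgM z z' l l' : ccvg z l -> ccvg z' l' ->
  ccvg (fun k => z k * z' k) (l * l').
Proof.
have ReM (a b : R[i]) : complex.Re (a * b) =
    complex.Re a * complex.Re b - complex.Im a * complex.Im b.
  by case: a b => [? ?] [].
have ImM (a b : R[i]) : complex.Im (a * b) =
    complex.Re a * complex.Im b + complex.Im a * complex.Re b.
  by case: a b => [? ?] [].
move=> [h1 h2] [h1' h2']; split; rewrite ?ReM ?ImM.
  by under eq_fun do rewrite ReM; apply: cvgB; apply: cvgM.
by under eq_fun do rewrite ImM; apply: cvgD; apply: cvgM.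
Qed.

Lemma ccvg_sum (I : Type) (r : seq I) (P : pred I) (z : I -> K -> R[i])
    (l : I -> R[i]) :
  (forall i, P i -> ccvg (z i) (l i)) ->
  ccvg (fun k => \sum_(i <- r | P i) z i k) (\sum_(i <- r | P i) l i).
Proof.
move=> zl; elim: r => [|i r IH].
  by rewrite big_nil; under [X in ccvg X]eq_fun do rewrite big_nil; apply: ccvg_cst.
rewrite big_cons; under [X in ccvg X]eq_fun do rewrite big_cons.
by case: ifP => // Pi; apply: ccvgD => //; exact: zl.
Qed.

Lemma ccvg_prod (I : Type) (r : seq I) (z : I -> K -> R[i]) (l : I -> R[i]) :
  (forall i, ccvg (z i) (l i)) ->
  ccvg (fun k => \prod_(i <- r) z i k) (\prod_(i <- r) l i).
Proof.
move=> zl; elim: r => [|i r IH].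
  by rewrite big_nil; under [X in ccvg X]eq_fun do rewrite big_nil; apply: ccvg_cst.
rewrite big_cons; under [X in ccvg X]eq_fun do rewrite big_cons.
exact: ccvgM.
Qed.

Lemma ccvgX z l m : ccvg z l -> ccvg (fun k => z k ^+ m) (l ^+ m).
Proof.
move=> zl; elim: m => [|m IH].
  by rewrite expr0; under [X in ccvg X]eq_fun do rewrite expr0; apply: ccvg_cst.
by rewrite exprS; under [X in ccvg X]eq_fun do rewrite exprS; apply: ccvgM.
Qed.

Lemma ccvg_norm z l : ccvg z l ->
  ComplexField.Normc.normc (z k) @[k --> F] --> ComplexField.Normc.normc l.
Proof.
have normcE (a : R[i]) : ComplexField.Normc.normc a =
    Num.sqrt (complex.Re a ^+ 2 + complex.Im a ^+ 2) by case: a.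
move=> [h1 h2]; rewrite normcE; under eq_fun do rewrite normcE.
apply: continuous_cvg; first exact: realfun.sqrt_continuous.
by apply: cvgD; rewrite expr2; under eq_fun do rewrite expr2; apply: cvgM.
Qed.

End ComplexLimits.

Lemma ultra_ccvg (R : realType) (K : Type) (F : set_system K) (z : K -> R[i])
    (M : R) :
  UltraFilter F -> (\forall k \near F, ComplexField.Normc.normc (z k) <= M) ->
  exists l, ccvg F z l.
Proof.
move=> FU zM.
have normRe (a : R[i]) : `|complex.Re a| <= ComplexField.Normc.normc a.
  by case: a => a b /=; rewrite -sqrtr_sqr ler_wsqrtr // lerDl sqr_ge0.
have normIm (a : R[i]) : `|complex.Im a| <= ComplexField.Normc.normc a.
  by case: a => a b /=; rewrite -sqrtr_sqr ler_wsqrtr // lerDr sqr_ge0.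
have [a Ha] : exists a : R, complex.Re (z k) @[k --> F] --> a.
  by apply: (@ultra_bounded_cvg _ _ FU _ _ M); apply: filterS zM => k; apply: le_trans.
have [b Hb] : exists a : R, complex.Im (z k) @[k --> F] --> a.
  by apply: (@ultra_bounded_cvg _ _ FU _ _ M); apply: filterS zM => k; apply: le_trans.
by exists (a +i* b)%C.
Qed.

(** * Limits of torus points *)

Local Notation wt l u := (dot l (mnm_point _ u)).

Lemma wtE (R : realType) n (l : 'rV[R]_n) (u : 'X_{1..n}) :
  wt l u = \sum_i l 0 i * (u i)%:R.
Proof. by apply: eq_bigr => i _; rewrite mxE. Qed.

Lemma dotDl (R : realType) n (l l' x : 'rV[R]_n) : dot (l + l') x = dot l x + dot l' x.
Proof. by rewrite -big_split; apply: eq_bigr => i _; rewrite mxE mulrDl. Qed.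

Lemma dotZl (R : realType) n c (l x : 'rV[R]_n) : dot (c *: l) x = c * dot l x.
Proof. by rewrite mulr_sumr; apply: eq_bigr => i _; rewrite mxE mulrA. Qed.

Lemma dotNl (R : realType) n (l x : 'rV[R]_n) : dot (- l) x = - dot l x.
Proof. by rewrite -scaleN1r dotZl mulN1r. Qed.

Lemma dotDr (R : realType) n (l x y : 'rV[R]_n) : dot l (x + y) = dot l x + dot l y.
Proof. by rewrite -big_split; apply: eq_bigr => i _; rewrite mxE mulrDr. Qed.

Lemma dotZr (R : realType) n c (l x : 'rV[R]_n) : dot l (c *: x) = c * dot l x.
Proof. by rewrite mulr_sumr; apply: eq_bigr => i _; rewrite mxE mulrCA. Qed.

Lemma orthant0 (R : realType) n : orthant (0 : 'rV[R]_n).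
Proof. by move=> i; rewrite mxE. Qed.

(** Applied to the entries of [s], this selects the exponents of the initial form for the weight
    [l]. *)
Definition argmin_wt (R : realType) n (l : 'rV[R]_n) (s : seq 'X_{1..n}) (u : 'X_{1..n}) :=
  all (fun w => wt l u <= wt l w) s.

Section TorusLimit.
Variables (R : realType) (n : nat) (s : seq 'X_{1..n.+1}).
Variables (K : Type) (F : set_system K) (x : K -> 'I_n.+1 -> R[i]).
Context {FU : UltraFilter F}.
Hypothesis x_neq0 : forall k i, x k i != 0.
Hypothesis s_neq0 : s != [::].
Local Notation normc := ComplexField.Normc.normc.
Hypothesis x_last : normc (x k ord_max) @[k --> F] --> (0 : R).

Let L k : 'rV[R]_n.+1 := \row_i ln (normc (x k i)).

(* [sg] selects the dominant exponents.  Their differences with [u0] are the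
   columns of a matrix [D]; since [L *m D] converges, so does its image [w] under
   a generalized inverse of [D], and [L - w] kills [D]. *)
Lemma torus_split_cvg : exists (u0 : 'X_{1..n.+1}) (sg : pred 'X_{1..n.+1})
    (w : K -> 'rV[R]_n.+1) (om : 'rV[R]_n.+1),
  [/\ u0 \in s, sg u0,
   forall i, w k 0 i @[k --> F] --> om 0 i,
   forall u k, u \in s -> sg u -> wt (L k - w k) u = wt (L k - w k) u0 &
   forall u, u \in s -> ~~ sg u ->
     expR (wt (L k - w k) u - wt (L k - w k) u0) @[k --> F] --> (0 : R)].
Proof.
have [u0 u0s u0max] := ultra_argmax (fun u k => wt (L k) u) s_neq0.
(* The ratio of the moduli of the monomials [u] and [u0] at [x k]. Along [F] it is at most 1, so it
   has a limit [y u]; the dominant exponents are those with a positive limit. *)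
pose rho u k := expR (wt (L k) u - wt (L k) u0).
have /choice[y yP] : forall u, exists y : R, u \in s -> rho u k @[k --> F] --> y.
  move=> u; have [us|_] := boolP (u \in s); last by exists 0.
  have [|y] := @ultra_bounded_cvg _ _ FU R (rho u) 1; last by exists y.
  apply: filterS u0max => k /(_ u us); rewrite -subr_le0 => le0.
  by rewrite ger0_norm ?expR_ge0 // expR_le1.
have y_ge0 u : u \in s -> 0 <= y u.
  move=> us; apply: (closed_cvg (fun t : R => 0 <= t) _ _ _ (yP u us)).
  - exact: closed_ge.
  - by apply: filterE => k; apply: expR_ge0.
pose sg u := 0 < y u.
have sg0 : sg u0.
  suff -> : sg u0 = (0 < 1 :> R) by [].
  congr (_ < _); apply: (cvg_unique _ (yP _ u0s)) => //.
  have -> : rho u0 = fun=> 1 by apply/funext => k; rewrite /rho subrr expR0.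
  exact: cvg_cst.
pose D : 'M[R]_(n.+1, size s) := \matrix_(i, j)
  (if sg (nth u0 s j) then (nth u0 s j i)%:R - (u0 i)%:R else 0).
have mulD (l : 'rV[R]_n.+1) j : (l *m D) 0 j =
    if sg (nth u0 s j) then wt l (nth u0 s j) - wt l u0 else 0.
  rewrite mxE; under eq_bigr do rewrite mxE.
  case: ifP => _; last by rewrite big1 // => i _; rewrite mulr0.
  by rewrite !wtE -sumrB; apply: eq_bigr => i _; rewrite mulrBr.
pose w k := L k *m D *m pinvmx D.
pose d j := if sg (nth u0 s j) then ln (y (nth u0 s j)) else 0.
pose om : 'rV[R]_n.+1 := \row_i \sum_(j < size s) d j * pinvmx D j i.
have LD_cvg j : (L k *m D) 0 j @[k --> F] --> d j.
  under eq_fun do rewrite mulD.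
  rewrite /d; case: ifP => sgj; last exact: cvg_cst.
  have -> : (fun k => wt (L k) (nth u0 s j) - wt (L k) u0) =
      (fun k => ln (rho (nth u0 s j) k)) by apply/funext => k; rewrite /rho expRK.
  apply: continuous_cvg; first exact: continuous_ln.
  by apply: yP; rewrite mem_nth.
have w_cvg i : w k 0 i @[k --> F] --> om 0 i.
  rewrite mxE; under eq_fun do rewrite mxE.
  apply: cvg_sumr => j; apply: cvgM; [exact: LD_cvg | exact: cvg_cst].
have wtB l l' (u : 'X_{1..n.+1}) : wt (l - l') u = wt l u - wt l' u.
  by rewrite dotDl dotNl.
exists u0, sg, w, om; split=> //.
  move=> u k us sgu; have us' : (index u s < size s)%N by rewrite index_mem.
  have := mulD (L k - w k) (Ordinal us'); rewrite /= nth_index // sgu => h.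
  apply/eqP; rewrite -subr_eq0 -h mulmxBl.
  (* [L k *m D] lies in the row space of [D], on which [pinvmx D *m D] acts as the identity. *)
  by rewrite /w mulmxKpV ?submxMl // subrr mxE.
move=> u us; rewrite /sg -leNgt => yu.
have {yu} y0 : y u = 0 by apply/le_anti; rewrite yu y_ge0.
(* The correction by [w] multiplies [rho u], which tends to 0, by a factor with a finite limit. *)
have -> : (fun k => expR (wt (L k - w k) u - wt (L k - w k) u0)) =
    (fun k => rho u k * expR (wt (w k) u0 - wt (w k) u)).
  by apply/funext => k; rewrite -expRD !wtB; congr expR; ring.
rewrite -[X in _ --> X](mul0r (expR (wt om u0 - wt om u))) -y0.
have wt_cvg v : wt (w k) v @[k --> F] --> wt om v.
  rewrite wtE; under eq_fun do rewrite wtE.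
  by apply: cvg_sumr => j; apply: cvgM; [exact: w_cvg | exact: cvg_cst].
apply: cvgM; first exact: yP.
by apply: continuous_cvg; [exact: continuous_expR | apply: cvgB].
Qed.

(** Rescaled by [expR (- l k)], the points converge in the torus; after division by a dominant
    monomial, only the dominant exponents survive in the limit. [coef] is quantified after [l] and
    [a], so that one limit serves a polynomial and its derivatives together. *)
Lemma torus_limit : exists (l : 'rV[R]_n.+1) (a : 'I_n.+1 -> R[i]),
  [/\ 0 < l 0 ord_max, forall i, a i != 0 &
   forall coef : 'X_{1..n.+1} -> R[i],
     (forall k, \sum_(u <- s) coef u * \prod_i x k i ^+ u i = 0) ->
     \sum_(u <- s | argmin_wt l s u) coef u * \prod_i a i ^+ u i = 0].
Proof.
have [u0 [sg [w [om [u0s sg0 w_cvg sg_eq nsg_cvg]]]]] := torus_split_cvg.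
pose l k := L k - w k.
pose b i k := x k i * (expR (- l k 0 i))%:C%C.
have normx k i : normc (x k i) = expR (L k 0 i).
  by rewrite mxE lnK // posrE normc_gt0.
have normb i k : normc (b i k) = expR (w k 0 i).
  rewrite ComplexField.Normc.normcM normx normc_real ger0_norm ?expR_ge0 //.
  by rewrite -expRD; congr expR; rewrite /l !mxE; ring.
have ew_cvg i : expR (w k 0 i) @[k --> F] --> expR (om 0 i).
  by apply: continuous_cvg; [exact: continuous_expR | exact: w_cvg].
have /choice[a b_cvg] : forall i, exists z, ccvg F (b i) z.
  move=> i; apply: (@ultra_ccvg _ _ _ _ (expR (om 0 i) + 1)).
  under eq_near do rewrite normb.
  by apply: (cvgr_le _ (ew_cvg i)); rewrite ltrDl ltr01.
have a0 i : a i != 0.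
  have na : normc (a i) = expR (om 0 i).
    apply: (cvg_unique _ (ccvg_norm (b_cvg i))) => //.
    have -> : (fun k => normc (b i k)) = fun k => expR (w k 0 i).
      by apply/funext => k; apply: normb.
    exact: ew_cvg.
  apply: contra_eq_neq na => ->.
  by rewrite ComplexField.Normc.normc0 eq_sym gt_eqF // expR_gt0.
pose th u k := expR (wt (l k) u - wt (l k) u0).
have th_cvg u : u \in s -> th u k @[k --> F] --> ((sg u)%:R : R).
  move=> us; case: (boolP (sg u)) => sgu /=; last exact: nsg_cvg.
  have -> : th u = fun=> 1 by apply/funext => k; rewrite /th sg_eq // subrr expR0.
  exact: cvg_cst.
(* Each monomial is a factor common to all [u], times the relative size [th u k], times the monomial
   at the rescaled point. *)
have xE k (u : 'X_{1..n.+1}) : \prod_i x k i ^+ u i =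
    (expR (wt (l k) u0))%:C%C * ((th u k)%:C%C * \prod_i b i k ^+ u i).
  rewrite mulrA -rmorphM -expRD addrC subrK wtE expR_sum rmorph_prod -big_split.
  apply: eq_bigr => i _ /=; rewrite exprMn mulrCA -rmorphXn -rmorphM -expRM_natr.
  by rewrite -expRD mulNr subrr expR0 mulr1.
(* A single [k] provides the weight [- l k]. Its last entry is positive since the last coordinate of
   [x k] tends to 0 while [w] converges; [th u k < 1] makes the non-dominant exponents strictly
   heavier. *)
have [k [l_last thk]] : exists k, expR (l k 0 ord_max) < 1 /\
    forall u, u \in s -> ~~ sg u -> th u k < 1.
  have el_cvg : expR (l k 0 ord_max) @[k --> F] --> (0 : R).
    have -> : (fun k => expR (l k 0 ord_max)) =
        (fun k => normc (x k ord_max) * (expR (w k 0 ord_max))^-1).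
      by apply/funext => k; rewrite normx -expRB; congr expR; rewrite /l !mxE.
    rewrite -[X in _ --> X](mul0r (expR (om 0 ord_max))^-1).
    by apply: cvgM => //; apply: cvgV => //; rewrite gt_eqF ?expR_gt0.
  apply: (@filter_ex _ F); apply: filterI; first exact: (cvgr_lt _ el_cvg _ ltr01).
  apply: near_all_seq => u us; have [sgu|sgu] := boolP (sg u).
    by apply: filterE.
  by apply: filterS (cvgr_lt _ (nsg_cvg u us sgu) _ ltr01).
exists (- l k), a; split=> //.
  by rewrite mxE oppr_gt0 -expR_lt1.
have argminE u : u \in s -> argmin_wt (- l k) s u = sg u.
  move=> us; apply/allP/idP => [/(_ u0 u0s)|sgu v vs].
    by apply: contraLR => /(thk u us); rewrite expR_lt1 subr_lt0 !dotNl lerN2 -ltNge.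
  rewrite !dotNl lerN2 (sg_eq _ _ us sgu).
  have [sgv|/(thk v vs)] := boolP (sg v); first by rewrite (sg_eq _ _ vs sgv).
  by rewrite expR_lt1 subr_lt0; apply: ltW.
move=> coef coef0.
have {}coef0 k' : \sum_(u <- s) coef u * ((th u k')%:C%C * \prod_i b i k' ^+ u i) = 0.
  have ek : (expR (wt (l k') u0))%:C%C != 0 :> R[i].
    by rewrite (inj_eq (@complexI _)) expR_eq0.
  apply: (mulfI ek); rewrite mulr0 -[RHS](coef0 k') mulr_sumr.
  by apply: eq_bigr => u _; rewrite xE mulrCA.
rewrite big_mkcond /=; apply: (@ccvg_unique _ _ F _ (fun=> 0)); last exact: ccvg_cst.
rewrite (_ : (fun=> 0) = fun k' => \sum_(u <- s) coef u *
    ((th u k')%:C%C * \prod_i b i k' ^+ u i)); last exact/funext.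
have -> : \sum_(u <- s) (if argmin_wt (- l k) s u then coef u * \prod_i a i ^+ u i else 0)
    = \sum_(u <- s) coef u * ((sg u)%:R%:C%C * \prod_i a i ^+ u i).
  rewrite big_seq [RHS]big_seq; apply: eq_bigr => u us; rewrite argminE //.
  by case: (sg u); rewrite /= ?mul1r // mul0r mulr0.
rewrite [X in ccvg _ _ X]big_seq.
rewrite (_ : (fun k' => _) = fun k' => \sum_(u <- s | u \in s) coef u *
    ((th u k')%:C%C * \prod_i b i k' ^+ u i)); last first.
  by apply/funext => k'; rewrite big_seq.
apply: ccvg_sum => u us; apply: ccvgM; first exact: ccvg_cst.
apply: ccvgM; first by apply: ccvg_real; exact: th_cvg.
by apply: ccvg_prod => i; apply: ccvgX; exact: b_cvg.
Qed.
End TorusLimit.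

(** * Compact faces of Newton polyhedra *)

Lemma convex_setP (R : realType) (M : lmodType R) (A : set M) :
  @convex_set R M A <-> forall x y (t : R), A x -> A y -> 0 <= t -> t <= 1 ->
    A (t *: x + (1 - t) *: y).
Proof.
split=> [cA x y t Ax Ay t0 t1|cA x y t /set_mem Ax /set_mem Ay].
  by have /set_mem := cA x y (Itv01 t0 t1) (mem_set Ax) (mem_set Ay).
apply/mem_set; exact: cA.
Qed.

(** Dividing by the total weight makes the tail of the list an instance of the same statement, so
    induction applies; a tail of total weight 0 has only zero coefficients. *)
Lemma convex_sum (R : realType) (M : lmodType R) (A : set M) (I : eqType)
    (r : seq I) (c : I -> R) (p : I -> M) :
  @convex_set R M A -> (forall i, 0 <= c i) -> (forall i, A (p i)) ->
  0 < \sum_(i <- r) c i ->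
  A ((\sum_(i <- r) c i)^-1 *: \sum_(i <- r) c i *: p i).
Proof.
move=> /convex_setP cA c0 Ap; elim: r => [|i r IH]; first by rewrite big_nil ltxx.
rewrite !big_cons; set W := \sum_(j <- r) c j.
have : 0 <= W by apply: sumr_ge0.
rewrite le_eqVlt => /predU1P[W0|W0 cW].
  have -> : \sum_(j <- r) c j *: p j = 0.
    move/esym/eqP: W0; rewrite /W psumr_eq0 // => /allP c_eq0.
    by rewrite big_seq big1 // => j /c_eq0 /eqP ->; rewrite scale0r.
  rewrite -W0 !addr0 => ci0; rewrite scalerA mulVf ?scale1r ?gt_eqF //.
have := cA _ _ (c i / (c i + W)) (Ap i) (IH W0).
have -> : 1 - c i / (c i + W) = W / (c i + W) by field; rewrite gt_eqF.
rewrite !scalerA [W / _ * _]mulrAC mulfV ?gt_eqF // mul1r.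
rewrite scalerDr scalerA [_^-1 * c i]mulrC ; apply.
  by rewrite divr_ge0 // ltW.
by rewrite ler_pdivrMr // mul1r lerDl ltW.
Qed.

Section NewtonPolyhedron.
Variables (R : realType) (n : nat) (g : {mpoly R[i][n.+1]}).
Local Notation P := (newton_polyhedron g).

Lemma newton_generator (u : 'X_{1..n.+1}) (y : 'rV[R]_n.+1) :
  u \in msupp g -> orthant y -> P (mnm_point R u + y).
Proof.
move=> ug oy; apply: sub_gen_smallest; exists u; last by exists y.
by rewrite /= -mcoeff_msupp.
Qed.

Lemma newton_convex : @convex_set R 'rV[R]_n.+1 P.
Proof.
apply/convex_setP => x y t Px Py t0 t1 A [cA gA].
by move/convex_setP: (cA); apply => //; [exact: Px | exact: Py].
Qed.

Lemma newton_sub (A : set 'rV[R]_n.+1) : @convex_set R 'rV[R]_n.+1 A ->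
  (forall u y, u \in msupp g -> orthant y -> A (mnm_point R u + y)) -> P `<=` A.
Proof.
move=> cA gA; apply: smallest_sub => // _ [u /= gu [y oy <-]].
by apply: gA => //; rewrite mcoeff_msupp.
Qed.

Lemma newton_point (u : 'X_{1..n.+1}) : u \in msupp g -> P (mnm_point R u).
Proof.
by move=> ug; have := newton_generator ug (@orthant0 R n.+1); rewrite addr0.
Qed.

(** The preimage of the polyhedron under translation by [y] is convex and contains the
    generators. *)
Lemma newton_addr x y : P x -> orthant y -> P (x + y).
Proof.
move=> Px oy; move: x Px; apply: newton_sub.
  apply/convex_setP => x x' t Px Px' t0 t1; rewrite /mkset.
  have -> : t *: x + (1 - t) *: x' + y = t *: (x + y) + (1 - t) *: (x' + y).
    by apply/rowP => i; rewrite !mxE; ring.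
  by move/convex_setP: newton_convex; apply.
move=> u z ug oz; rewrite /mkset -addrA; apply: newton_generator => // i.
by rewrite mxE addr_ge0.
Qed.

Lemma newton_dot_ge (l : 'rV[R]_n.+1) (m : R) : orthant l ->
  (forall u, u \in msupp g -> m <= wt l u) -> forall x, P x -> m <= dot l x.
Proof.
move=> l0 lm; apply: newton_sub.
  apply/convex_setP => x y t /= mx my t0 t1; rewrite /mkset dotDr !dotZr.
  have t1' : 0 <= 1 - t by rewrite subr_ge0.
  have := ler_wpM2l t0 mx; have := ler_wpM2l t1' my; lra.
move=> u y ug oy; rewrite /mkset dotDr (le_trans (lm u ug)) // lerDl.
by apply: sumr_ge0 => i _; rewrite mulr_ge0.
Qed.

Definition newton_face (l : 'rV[R]_n.+1) : set 'rV[R]_n.+1 :=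
  [set x | P x /\ forall y, P y -> dot l x <= dot l y].

(** For a nonnegative weight, a lower bound on the support extends to the whole polyhedron, so
    minimality can be tested on exponents. *)
Lemma newton_face_point (l : 'rV[R]_n.+1) u : orthant l -> u \in msupp g ->
  (mnm_point R u \in newton_face l) = argmin_wt l (msupp g) u.
Proof.
move=> l0 ug; apply/idP/allP => [/set_mem[_ umin] v vg|umin].
  by apply: umin; apply: newton_point.
apply/mem_set; split; first exact: newton_point.
by apply: newton_dot_ge.
Qed.

(** If [l 0 i <= 0], moving a point of the face along the [i]-th axis stays in the polyhedron
    without increasing the form, so the face contains a ray. *)
Lemma compact_face_gt0 (l : 'rV[R]_n.+1) : newton_face l !=set0 ->
  compact (newton_face l) -> forall i, 0 < l 0 i.
Proof.
move=> [x [Px xmin]] cF i; rewrite ltNge; apply/negP => li0.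
have ci : compact ((fun v : 'rV[R]_n.+1 => v 0 i : R^o) @` newton_face l).
  apply: continuous_compact => //; apply: continuous_subspaceT => v.
  exact: coord_continuous.
have [M [_ /(_ (M + 1))]] := compact_bounded ci.
rewrite ltrDl ltr01 => /(_ isT) FM.
(* Large enough that [x 0 i + s] exceeds the bound [M + 1]. *)
pose s : R := `|M| + `|x 0 i| + 2.
have s0 : 0 <= s by rewrite !addr_ge0.
pose y : 'rV[R]_n.+1 := s *: delta_mx 0 i.
have oy : orthant y by move=> j; rewrite !mxE mulr_ge0.
have yi : y 0 i = s by rewrite !mxE !eqxx mulr1.
have dy : dot l y <= 0.
  rewrite dotZr mulr_ge0_le0 // /dot (bigD1 i) //= big1 ?addr0.
    by rewrite mxE !eqxx mulr1.
  by move=> j ji; rewrite mxE (negPf ji) andbF mulr0.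
have : newton_face l (x + y).
  split=> [|z /xmin]; first exact: newton_addr.
  by apply: le_trans; rewrite dotDr gerDl.
move=> xyF.
have /FM : ((fun v : 'rV[R]_n.+1 => v 0 i : R^o) @` newton_face l) ((x + y) 0 i).
  by exists (x + y).
rewrite /= mxE yi ler_norml => /andP[_]; rewrite /s.
have := ler_norm (- x 0 i); rewrite normrN; have := ler_norm M; lra.
Qed.

(** Sums of this shape form a convex set that contains the generators. *)
Lemma newton_decomposition x : P x -> let s := msupp g in
  exists (c : 'rV[R]_(size s)) (y : 'rV[R]_n.+1),
  [/\ forall j, 0 <= c 0 j, \sum_j c 0 j = 1, orthant y &
      x = \sum_j c 0 j *: mnm_point R (nth 0%MM s j) + y].
Proof.
move=> Px s; move: x Px; apply: newton_sub.
  apply/convex_setP => _ _ t [c [y [c0 c1 oy ->]]] [c' [y' [c0' c1' oy' ->]]] t0 t1.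
  have t1' : 0 <= 1 - t by rewrite subr_ge0.
  exists (t *: c + (1 - t) *: c'), (t *: y + (1 - t) *: y'); split.
  - by move=> j; rewrite !mxE addr_ge0 // mulr_ge0.
  - under eq_bigr do rewrite !mxE.
    by rewrite big_split /= -!mulr_sumr c1 c1' !mulr1 addrC subrK.
  - by move=> j; rewrite !mxE addr_ge0 // mulr_ge0.
  - rewrite !scalerDr addrACA; congr (_ + _).
    rewrite !scaler_sumr -big_split; apply: eq_bigr => j _ /=.
    by rewrite !mxE !scalerA -scalerDl.
move=> u y us oy; have us' : (index u s < size s)%N by rewrite index_mem.
exists (delta_mx 0 (Ordinal us')), y; split=> //.
- by move=> j; rewrite mxE.
- rewrite (bigD1 (Ordinal us')) //= big1 ?addr0 ?mxE ?eqxx // => j ji.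
  by rewrite mxE (negPf ji) andbF.
- rewrite (bigD1 (Ordinal us')) //= big1 ?addr0 ?mxE ?eqxx ?scale1r ?nth_index // => j ji.
  by rewrite mxE (negPf ji) andbF scale0r.
Qed.

(** A positive weight leaves a minimizer no orthant component, so the face is the continuous image
    of a closed part [A] of a simplex. *)
Lemma compact_newton_face (l : 'rV[R]_n.+1) : (forall i, 0 < l 0 i) ->
  compact (newton_face l).
Proof.
move=> l0; have [->|/set0P[x0 [Px0 x0min]]] := eqVneq (newton_face l) set0.
  exact: compact0.
set s := msupp g.
pose phi (c : 'rV[R]_(size s)) := \sum_j c 0 j *: mnm_point R (nth 0%MM s j).
pose A : set 'rV[R]_(size s) := [set c : 'rV[R]_(size s) | [/\ forall j, 0 <= c 0 j <= 1,
  \sum_j c 0 j = 1 & dot l (phi c) <= dot l x0]].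
have phiP (c : 'rV[R]_(size s)) : (forall j, 0 <= c 0 j) -> \sum_j c 0 j = 1 -> P (phi c).
  move=> c0 c1.
  have := @convex_sum R 'rV[R]_n.+1 P _ (index_enum 'I_(size s)) (fun j => c 0 j)
    (fun j => mnm_point R (nth 0%MM s j)) newton_convex c0.
  rewrite c1 invr1 scale1r; apply; last exact: ltr01.
  by move=> j; apply: newton_point; rewrite mem_nth.
have phi_cont (F : set_system 'rV[R]_(size s)) (c : 'rV[R]_(size s)) :
    Filter F -> F --> c -> phi @ F --> phi c.
  move=> FF Fc; apply: cvg_rV => i.
  have phiE c' : phi c' 0 i = \sum_j c' 0 j * mnm_point R (nth 0%MM s j) 0 i.
    by rewrite summxE; apply: eq_bigr => j _; rewrite mxE.
  rewrite phiE (_ : (fun k => _) =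
      fun k : 'rV[R]_(size s) => \sum_j k 0 j * mnm_point R (nth 0%MM s j) 0 i).
    apply: cvg_sumr => j; apply: cvgM; last exact: cvg_cst.
    exact: (continuous_cvg _ (@coord_continuous _ _ _ _ _ _) Fc).
  by apply/funext => c'; apply: phiE.
have -> : newton_face l = phi @` A.
  apply/seteqP; split=> [x [Px xmin]|_ [c [c0 c1 cx0] <-]].
    have [c [y [c0 c1 oy xE]]] := newton_decomposition Px.
    (* Minimality gives [dot l y <= 0], while each [l 0 i * y 0 i] is at most [dot l y]. *)
    have y0 : y = 0.
      apply/rowP => i; rewrite [RHS]mxE; apply/eqP; rewrite eq_le oy andbT.
      rewrite -(pmulr_rle0 _ (l0 i)).
      have := xmin _ (phiP c c0 c1); rewrite xE dotDr gerDl.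
      apply: le_trans; rewrite /dot (bigD1 i) //= lerDl.
      by apply: sumr_ge0 => j _; rewrite mulr_ge0 // ltW.
    exists c; last by rewrite xE y0 addr0.
    split=> // [j|]; last by move: (xmin _ Px0); rewrite xE y0 addr0.
    rewrite c0 -c1 (bigD1 j) //= lerDl.
    by apply: sumr_ge0 => ? _.
  have Pc : P (phi c) by apply: phiP => // j; have /andP[] := c0 j.
  by split=> // y /x0min; apply: le_trans.
apply: continuous_compact.
  by apply: continuous_subspaceT => c; exact: (phi_cont (nbhs c)).
pose Q : set 'rV[R]_(size s) := [set c : 'rV[R]_(size s) | forall j, `[0, 1]%classic (c 0 j)].
have : compact Q.
  by apply: (@rV_compact R _ (fun=> `[0, 1]%classic)) => j; exact: segment_compact.
(* An ultrafilter on [A] converges in the cube [Q], and the conditions defining [A] pass to the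
   limit. *)
rewrite !compact_ultra => Q_ultra F FU FA.
have FQ : F Q by apply: filterS FA => c [c01 _ _] j; rewrite /= in_itv c01.
have [c [Qc Fc]] := Q_ultra F FU FQ.
have coord j : (k : 'rV[R]_(size s)) 0 j @[k --> F] --> c 0 j.
  exact: (continuous_cvg _ (@coord_continuous _ _ _ _ _ _) Fc).
exists c; split=> //; split=> [j||].
- by have := Qc j; rewrite /= in_itv.
- pose sm (k : 'rV[R]_(size s)) : R := \sum_j k 0 j.
  have sum_cvg : sm k @[k --> F] --> sm c by apply: cvg_sumr.
  have one_cvg : sm k @[k --> F] --> (1 : R).
    by apply: cvg_near_cst; apply: filterS FA => k [].
  exact: (cvg_unique _ sum_cvg one_cvg).
- have dot_cvg : dot l (phi k) @[k --> F] --> dot l (phi c).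
    apply: cvg_sumr => i; apply: cvgM; first exact: cvg_cst.
    exact: (continuous_cvg _ (@coord_continuous _ _ _ _ _ _) (phi_cont F c _ Fc)).
  apply: (closed_cvg (fun t : R => t <= dot l x0) _ _ _ dot_cvg).
    exact: closed_le.
  by apply: filterS FA => k [].
Qed.

End NewtonPolyhedron.

(** * Translation of the last variable *)

Section FacePoly.
Variables (R : realType) (n : nat) (g : {mpoly R[i][n]}) (tau : set 'rV[R]_n).

Lemma meval_face_poly x : (face_poly g tau).@[x] =
  \sum_(v <- msupp g | mnm_point R v \in tau) g@_v * \prod_i x i ^+ v i.
Proof.
rewrite /face_poly raddf_sum /=; apply: eq_bigr => v _.
by rewrite mevalZ mevalX.
Qed.

(** The logarithmic derivative keeps the exponents of the polynomial, and on the torus it vanishes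
    together with the partial derivative. *)
Lemma meval_mderiv_face_poly x i : x i * ((face_poly g tau)^`M(i)).@[x] =
  \sum_(v <- msupp g | mnm_point R v \in tau) g@_v * ((v i)%:R * \prod_j x j ^+ v j).
Proof.
rewrite /face_poly (raddf_sum (mderiv i)) raddf_sum mulr_sumr; apply: eq_bigr => v _ /=.
rewrite mderivZ mderivX !mevalZ mevalX mulrCA; congr (_ * _); rewrite mulrCA.
(* For [v i = 0] the exponent subtraction is truncated, but the factor [v i] kills both sides. *)
case: (posnP (v i)) => [->|vi0]; first by rewrite !mul0r.
congr (_ * _); rewrite [RHS](bigD1 i) //= [X in _ * X](bigD1 i) //= mulrA.
congr (_ * _); first by rewrite mnmBE mnm1E eqxx subn1 -exprS prednK.
by apply: eq_bigr => j ji; rewrite mnmBE mnm1E eq_sym (negPf ji) subn0.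
Qed.

End FacePoly.

Lemma argmin_wt_exists (R : realType) n (l : 'rV[R]_n) (s : seq 'X_{1..n}) :
  s != [::] -> exists2 u, u \in s & argmin_wt l s u.
Proof.
case: s => // v s _; elim: s v => [|v' s IH] v.
  by exists v; rewrite ?mem_head // /argmin_wt /= lexx.
have [u us umin] := IH v'; have [uv|vu] := leP (wt l u) (wt l v).
  by exists u; [rewrite inE us orbT | rewrite /argmin_wt /= uv].
exists v; first exact: mem_head.
apply/allP => w; rewrite inE => /predU1P[->//|/(allP umin)]; apply: le_trans.
exact: ltW.
Qed.

(** The last entry is set to 0 rather than removed, so that a projected exponent can itself be an
    exponent of the translate. *)
Definition drop_last n (u : 'X_{1..n.+1}) : 'X_{1..n.+1} :=
  [multinom (if i == ord_max then 0%N else u i) | i < n.+1].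

Lemma drop_lastE n (u : 'X_{1..n.+1}) i :
  drop_last u i = if i == ord_max then 0%N else u i.
Proof. by rewrite mnmE. Qed.

Lemma drop_last_inj n (u v : 'X_{1..n.+1}) :
  drop_last u = drop_last v -> u ord_max = v ord_max -> u = v.
Proof.
move=> uv uvm; apply/mnmP => i; have [->//|im] := eqVneq i ord_max.
by move/mnmP/(_ i): uv; rewrite !drop_lastE (negPf im).
Qed.

Section Shift.
Variables (R : realType) (n : nat) (f : {mpoly R[i][n.+1]}) (c : R[i]).
Local Notation g := (shift_last c f).

(** The coefficient of ['X_[u]] in the translate of ['X_[w]], by the binomial formula. *)
Let term (w u : 'X_{1..n.+1}) : R[i] :=
  \sum_(i < (w ord_max).+1) (c ^+ i *+ 'C(w ord_max, i)) *
    (drop_last w + U_(ord_max) *+ (w ord_max - i) == u)%MM%:R.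

Lemma mcoeff_shift_last u : g@_u = \sum_(w <- msupp f) f@_w * term w u.
Proof.
rewrite /shift_last comp_mpolyE raddf_sum /=; apply: eq_bigr => w _.
rewrite mcoeffZ; congr (_ * _).
rewrite (bigD1 ord_max) //= tnth_mktuple eqxx.
rewrite (eq_bigr (fun i => 'X_i ^+ drop_last w i)); last first.
  by move=> i im; rewrite tnth_mktuple (negPf im) drop_lastE (negPf im).
have -> : \prod_(i < n.+1 | i != ord_max) 'X_i ^+ drop_last w i =
    'X_[drop_last w] :> {mpoly R[i][n.+1]}.
  by rewrite [RHS]mpolyXE_id [RHS](bigD1 ord_max) //= drop_lastE eqxx expr0 mul1r.
rewrite exprDn mulr_suml raddf_sum /=; apply: eq_bigr => i _.
rewrite -mcoeffX -mcoeffZ; congr (_@_u).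
rewrite -mul_mpolyC rmorphMn rmorphXn /= mpolyXD -mpolyXn !mulrnAl; congr (_ *+ _).
by rewrite [X in X * _]mulrC -!mulrA [X in _ * X]mulrC.
Qed.

Lemma term_neq0 w u : term w u != 0 -> drop_last w = drop_last u.
Proof.
apply: contra_neq_eq => wu; rewrite /term big1 // => i _.
case: eqP => [E|_]; last by rewrite mulr0.
case/eqP: wu; rewrite -E; apply/mnmP => j; rewrite !drop_lastE.
case: eqP => // /eqP jm; rewrite mnmDE drop_lastE (negPf jm) mulmnE mnm1E.
by rewrite eq_sym (negPf jm) mul0n addn0.
Qed.

(** Only the binomial summand free of the last variable, of index [w ord_max], can contribute. *)
Lemma term_last0 w (u : 'X_{1..n.+1}) : u ord_max = 0%N ->
  term w u = if drop_last w == u then c ^+ w ord_max else 0.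
Proof.
move=> u0; rewrite /term (bigD1 ord_max) //= subnn mulm0n addm0 binn mulr1n.
rewrite big1 ?addr0 => [|i im]; first by case: eqP; rewrite ?mulr1 ?mulr0.
case: eqP => [E|_]; last by rewrite mulr0.
move/mnmP/(_ ord_max)/eqP: E; rewrite u0 mnmDE mulmnE mnm1E eqxx mul1n addn_eq0.
case/andP=> _; rewrite subn_eq0 => mi; case/eqP: im; apply: val_inj => /=.
by apply/anti_leq; rewrite mi -ltnS ltn_ord.
Qed.

Lemma mcoeff_shift_last0 (u : 'X_{1..n.+1}) : u ord_max = 0%N ->
  g@_u = \sum_(w <- msupp f | drop_last w == u) f@_w * c ^+ w ord_max.
Proof.
move=> u0; rewrite mcoeff_shift_last [RHS]big_mkcond; apply: eq_bigr => w _.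
by rewrite term_last0 //; case: ifP => _; rewrite ?mulr0.
Qed.

Lemma msupp_shift_last u : u \in msupp g ->
  exists2 w, w \in msupp f & drop_last w = drop_last u.
Proof.
rewrite mcoeff_msupp mcoeff_shift_last => h; apply: contrapT => nw.
case/eqP: h; rewrite big_seq big1 // => w wf.
have [->|/term_neq0 E] := eqVneq (term w u) 0; first by rewrite mulr0.
by case: nw; exists w.
Qed.

(* The coefficient in [f] of the monomial [drop_last w], a polynomial in [x_n]. *)
Definition last_coef (w : 'X_{1..n.+1}) : {poly R[i]} :=
  \sum_(v <- msupp f | drop_last v == drop_last w) f@_v *: 'X^(v ord_max).

(** Its coefficient in degree [w ord_max] is [f@_w], as the projection and the last entry determine
    an exponent. *)
Lemma last_coef_neq0 w : w \in msupp f -> last_coef w != 0.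
Proof.
move=> wf; apply: contraTneq (wf) => q0; rewrite mcoeff_msupp negbK; apply/eqP.
rewrite -[RHS](coef0 _ (w ord_max)) -q0 coef_sum big_mkcond (bigD1_seq w) ?msupp_uniq //=.
rewrite eqxx coefZ coefXn eqxx mulr1 big1 ?addr0 // => v nvw; case: eqP => // vw.
rewrite coefZ coefXn; case: eqP => [E|_]; last by rewrite mulr0.
by case/eqP: nvw; apply: drop_last_inj.
Qed.

Hypothesis c_generic : forall w, w \in msupp f -> (last_coef w).[c] != 0.

(** The coefficient of this exponent in the translate is [(last_coef f w).[c]]. *)
Lemma drop_last_msupp w : w \in msupp f -> drop_last w \in msupp g.
Proof.
move=> wf; rewrite mcoeff_msupp mcoeff_shift_last0 ?drop_lastE ?eqxx //.
have := c_generic wf; rewrite /last_coef horner_sum.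
by congr (_ != _); apply: eq_bigr => v _; rewrite hornerZ hornerXn.
Qed.

Definition drop_wt (l : 'rV[R]_n.+1) : 'rV[R]_n.+1 :=
  \row_i (if i == ord_max then 0 else l 0 i).

Lemma wt_drop_wt l (u : 'X_{1..n.+1}) : wt (drop_wt l) u = wt l (drop_last u).
Proof.
rewrite !wtE; apply: eq_bigr => i _; rewrite mxE drop_lastE.
by case: ifP; rewrite ?mul0r ?mulr0.
Qed.

Lemma wt_drop_last (l : 'rV[R]_n.+1) (u : 'X_{1..n.+1}) :
  wt l u = wt l (drop_last u) + l 0 ord_max * (u ord_max)%:R.
Proof.
rewrite !wtE (bigD1 ord_max) //= [in RHS](bigD1 ord_max) //= drop_lastE eqxx.
rewrite mulr0 add0r addrC; congr (_ + _); apply: eq_bigr => i im.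
by rewrite drop_lastE (negPf im).
Qed.

(** Replacing the last entry of an exponent by 0 stays in the support of the translate and lowers a
    positive weight, so the minimizers are the projections of those of [f] for [drop_wt l]. The free
    [phi] covers both values and logarithmic derivatives. *)
Lemma face_sum_shift_last (l : 'rV[R]_n.+1) (phi : 'X_{1..n.+1} -> R[i]) :
  (forall i, 0 < l 0 i) ->
  \sum_(u <- msupp g | argmin_wt l (msupp g) u) g@_u * phi u =
  \sum_(w <- msupp f | argmin_wt (drop_wt l) (msupp f) w)
    f@_w * c ^+ w ord_max * phi (drop_last w).
Proof.
move=> l0.
have wt_ge u : wt l (drop_last u) <= wt l u.
  by rewrite [leRHS]wt_drop_last lerDl mulr_ge0 // ltW.
have argmin0 u : u \in msupp g -> argmin_wt l (msupp g) u -> u ord_max = 0%N.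
  move=> ug /allP umin; have [w wf wu] := msupp_shift_last ug.
  have := umin _ (drop_last_msupp wf); rewrite wu [leLHS]wt_drop_last gerDl.
  by rewrite pmulr_rle0 // lern0 => /eqP.
have argminE w : w \in msupp f ->
    argmin_wt l (msupp g) (drop_last w) = argmin_wt (drop_wt l) (msupp f) w.
  move=> wf; apply/allP/allP => h v.
    by move=> vf; rewrite !wt_drop_wt; apply/h/drop_last_msupp.
  move=> /msupp_shift_last[w' w'f w'v]; apply: le_trans (wt_ge v).
  by rewrite -w'v -!wt_drop_wt; apply: h.
transitivity (\sum_(u <- msupp g | argmin_wt l (msupp g) u)
   \sum_(w <- msupp f | drop_last w == u) f@_w * c ^+ w ord_max * phi (drop_last w)).
  rewrite big_seq_cond [RHS]big_seq_cond; apply: eq_bigr => u /andP[ug umin].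
  rewrite mcoeff_shift_last0 ?(argmin0 u) // mulr_suml.
  by apply: eq_bigr => w /eqP ->.
(* After the exchange, each [w] contributes only at [u = drop_last w]. *)
rewrite (exchange_big_dep xpredT) //= [RHS]big_mkcond big_seq [RHS]big_seq.
apply: eq_bigr => w wf; rewrite -argminE //.
case: ifP => am; last first.
  by rewrite big1 // => u /andP[+ /eqP E]; rewrite -E am.
rewrite big_mkcond (bigD1_seq (drop_last w)) ?msupp_uniq ?drop_last_msupp //=.
rewrite am eqxx big1 ?addr0 // => u nu.
by rewrite eq_sym (negPf nu) andbF.
Qed.
End Shift.

(** * Fibers with a singular point *)

Section DegenerateFiber.
Variables (R : realType) (n : nat) (f : {mpoly R[i][n.+1]}).

(** Logarithmic derivatives keep every polynomial supported on [s], so one limiting argument handles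
    the whole system. *)
Definition fiber_system (s : seq 'X_{1..n.+1}) : seq {mpoly R[i][n.+1]} :=
  \sum_(w <- s) f@_w *: 'X_[w] ::
  [seq \sum_(w <- s) (f@_w * (w i)%:R) *: 'X_[w] | i <- enum 'I_n.+1 & i != ord_max].

Lemma fiber_systemP s (x : 'I_n.+1 -> R[i]) :
  (forall p, p \in fiber_system s -> p.@[x] = 0) <->
  \sum_(w <- s) f@_w * \prod_i x i ^+ w i = 0 /\
  forall i, i != ord_max -> \sum_(w <- s) f@_w * (w i)%:R * \prod_j x j ^+ w j = 0.
Proof.
have ev (c : 'X_{1..n.+1} -> R[i]) :
    (\sum_(w <- s) c w *: 'X_[w]).@[x] = \sum_(w <- s) c w * \prod_j x j ^+ w j.
  by rewrite raddf_sum; apply: eq_bigr => w _ /=; rewrite mevalZ mevalX.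
split=> [h|[h0 hi] p].
  split; first by rewrite -ev; apply: h; rewrite mem_head.
  move=> i im; rewrite -ev; apply: h; rewrite inE; apply/orP; right.
  by apply/mapP; exists i; rewrite // mem_filter im mem_enum.
rewrite inE => /predU1P[->|]; first by rewrite ev.
by case/mapP=> i; rewrite mem_filter => /andP[im _] ->; rewrite ev hi.
Qed.

(* The [c] at which the restriction to [x_n = c] of the part of [f] supported
   on [s] has a singular zero in the torus: [fiber_system] omits the logarithmic
   derivative in the last variable. *)
Definition degenerate_fibers (s : seq 'X_{1..n.+1}) : set R[i] :=
  [set c | exists x : 'I_n.+1 -> R[i],
    [/\ forall i, x i != 0, x ord_max = c &
        forall p, p \in fiber_system s -> p.@[x] = 0]].

Definition face_support (l : 'rV[R]_n.+1) := [seq u <- msupp f | argmin_wt l (msupp f) u].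

Lemma degenerate_shift_last c : c != 0 ->
  (forall w, w \in msupp f -> (last_coef f w).[c] != 0) ->
  ~ newton_nondegenerate (shift_last c f) ->
  exists l : 'rV[R]_n.+1, [/\ l 0 ord_max = 0, forall i, i != ord_max -> 0 < l 0 i &
    degenerate_fibers (face_support l) c].
Proof.
move=> c0 c_gen; set g := shift_last c f => deg.
have [tau [[tau0 [l tauE]] ctau [x [x0 [fx0 dfx0]]]]] : exists tau,
    [/\ is_face (newton_polyhedron g) tau, compact tau & exists x : 'I_n.+1 -> R[i],
      (forall i, x i != 0) /\ ((face_poly g tau).@[x] = 0 /\
      forall i, ((face_poly g tau)^`M(i)).@[x] = 0)].
  apply: contrapT => no; apply: deg => tau ft ct x x0 [h1 h2].
  by apply: no; exists tau; split=> //; exists x.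
have l0 : forall i, 0 < l 0 i by apply: (@compact_face_gt0 _ _ g); rewrite /newton_face -tauE.
have ol : orthant l by move=> i; apply: ltW.
exists (drop_wt l); split.
- by rewrite mxE eqxx.
- by move=> i im; rewrite mxE (negPf im).
(* The face polynomial of the translate does not involve the last variable, so that coordinate may
   be reset to [c]; [c != 0] keeps [y] in the torus. *)
pose y i := if i == ord_max then c else x i.
exists y; split.
- by move=> i; rewrite /y; case: ifP.
- by rewrite /y eqxx.
have yE (w : 'X_{1..n.+1}) :
    c ^+ w ord_max * \prod_i x i ^+ drop_last w i = \prod_i y i ^+ w i.
  rewrite [RHS](bigD1 ord_max) //= /y eqxx; congr (_ * _).
  rewrite (bigD1 ord_max) //= drop_lastE eqxx expr0 mul1r.
  by apply: eq_bigr => i im; rewrite drop_lastE (negPf im).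
have face_sum (phi : 'X_{1..n.+1} -> R[i]) :
    \sum_(v <- msupp g | mnm_point R v \in tau) g@_v * phi v =
    \sum_(w <- face_support (drop_wt l)) f@_w * c ^+ w ord_max * phi (drop_last w).
  rewrite big_filter -face_sum_shift_last // big_seq_cond [RHS]big_seq_cond.
  apply: eq_bigl => v; case: (boolP (v \in msupp g)) => //= vg.
  by rewrite -(newton_face_point ol vg) /newton_face -tauE.
apply/fiber_systemP; split.
  rewrite -[RHS]fx0 meval_face_poly face_sum.
  by apply: eq_bigr => w _; rewrite -mulrA yE.
move=> i im; transitivity (x i * ((face_poly g tau)^`M(i)).@[x]); last by rewrite dfx0 mulr0.
rewrite meval_mderiv_face_poly.
rewrite (face_sum (fun v => (v i)%:R * \prod_j x j ^+ v j)).
apply: eq_bigr => w _; rewrite -yE drop_lastE (negPf im); ring.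
Qed.

(** Positivity of [l] makes the face compact, and a nonzero last weight lets Euler's relation supply
    the one derivative absent from the system. *)
Lemma face_degenerate (l : 'rV[R]_n.+1) (a : 'I_n.+1 -> R[i]) :
  f != 0 -> (forall i, 0 < l 0 i) -> (forall i, a i != 0) ->
  (forall p, p \in fiber_system (face_support l) -> p.@[a] = 0) ->
  ~ newton_nondegenerate f.
Proof.
move=> f0 l0 a0 /fiber_systemP[fa dfa] nondeg.
have ol : orthant l by move=> i; apply: ltW.
have msupp0 : msupp f != [::] by rewrite msupp_eq0.
have [u0 u0f u0min] := argmin_wt_exists l msupp0.
have face_sum (phi : 'X_{1..n.+1} -> R[i]) :
    \sum_(v <- msupp f | mnm_point R v \in newton_face f l) f@_v * phi v =
    \sum_(w <- face_support l) f@_w * phi w.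
  rewrite big_filter big_seq_cond [RHS]big_seq_cond.
  apply: eq_bigl => v; case: (boolP (v \in msupp f)) => //= vf.
  exact: newton_face_point.
apply: (nondeg (newton_face f l) _ _ a a0).
- split; last by exists l.
  by exists (mnm_point R u0); apply/set_mem; rewrite newton_face_point.
- exact: compact_newton_face.
split; first by rewrite meval_face_poly face_sum.
have dfa' i : i != ord_max ->
    \sum_(w <- face_support l) f@_w * ((w i)%:R * \prod_j a j ^+ w j) = 0.
  by move=> im; rewrite -[RHS](dfa i im); apply: eq_bigr => w _; rewrite mulrA.
move=> i; apply: (mulfI (a0 i)); rewrite mulr0 meval_mderiv_face_poly.
rewrite (face_sum (fun v => (v i)%:R * \prod_j a j ^+ v j)).
have [->|im] := eqVneq i ord_max; last exact: dfa'.
(* Euler's relation: the weighted degree is constant on the face. *)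
have euler : \sum_j (l 0 j)%:C%C *
    (\sum_(w <- face_support l) f@_w * ((w j)%:R * \prod_j a j ^+ w j)) = 0.
  transitivity ((wt l u0)%:C%C * \sum_(w <- face_support l) f@_w * \prod_j a j ^+ w j).
    under eq_bigr do rewrite mulr_sumr.
    rewrite exchange_big mulr_sumr big_seq [RHS]big_seq; apply: eq_bigr => w /=.
    rewrite mem_filter => /andP[wmin wf].
    have -> : wt l u0 = wt l w.
      by apply/le_anti; rewrite (allP wmin) // (allP u0min).
    rewrite wtE rmorph_sum mulr_suml; apply: eq_bigr => j _ /=.
    by rewrite rmorphM rmorph_nat; ring.
  by rewrite fa mulr0.
move: euler; rewrite (bigD1 ord_max) //= [X in _ + X]big1 ?addr0 => [/eqP|j jm]; last first.
  by rewrite dfa' ?mulr0.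
rewrite mulf_eq0 => /orP[|/eqP //].
by rewrite (inj_eq (@complexI _) _ 0) gt_eqF.
Qed.

Lemma degenerate_fibers_finite (l : 'rV[R]_n.+1) : f != 0 ->
  newton_nondegenerate f -> l 0 ord_max = 0 -> (forall i, i != ord_max -> 0 < l 0 i) ->
  finite_set (degenerate_fibers (face_support l)).
Proof.
move=> f0 nondeg l_last l0; set s := face_support l.
have [//|cofin] := torus_system_finite_or_cofinite (fiber_system s).
exfalso; pose e (k : nat) : R := (k.+1%:R)^-1.
have e_gt0 k : 0 < e k by rewrite invr_gt0.
have {cofin}/choice[x xP] : forall k : nat, exists x : 'I_n.+1 -> R[i],
    [/\ forall i, x i != 0, ComplexField.Normc.normc (x ord_max) <= e k &
        forall p, p \in fiber_system s -> p.@[x] = 0].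
  move=> k; apply: contrapT => no.
  (* If the claim failed at [k], none of the infinitely many distinct values [e (k + j)], all at
     most [e k], would lie in the cofinite set. *)
  apply: (@infinite_nat); have ej : injective (fun j => (e (k + j)%N)%:C%C).
    move=> i j /complexI /invr_inj /eqP.
    by rewrite eqr_nat eqSS eqn_add2l => /eqP.
  apply: sub_finite_set (finite_preimage (in2W ej) cofin) => j _ /= [x [x0 xj px]].
  apply: no; exists x; split=> //.
  rewrite xj normc_real ger0_norm ?(ltW (e_gt0 _)) // lef_pV2 ?posrE //.
  by rewrite ler_nat ltnS leq_addr.
have [F [FU oF]] := ultraFilterLemma (@eventually_filter).
have x_last : ComplexField.Normc.normc (x k ord_max) @[k --> F] --> (0 : R).
  have e_cvg : e k @[k --> F] --> (0 : R) by move=> A /cvg_harmonic; apply: oF.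
  apply: (squeeze_cvgr _ (cvg_cst (0 : R)) e_cvg).
  apply: filterE => k; have [x0 xe _] := xP k.
  by rewrite xe ltW // normc_gt0.
have s0 : s != [::].
  have [|u uf umin] := @argmin_wt_exists _ _ l (msupp f); first by rewrite msupp_eq0.
  suff : u \in s by case: (s).
  by rewrite mem_filter umin.
have [|l1 [a [l1_last a0 coef_lim]]] := torus_limit _ s0 x_last.
  by move=> k i; have [] := xP k.
(* [l] is strictly larger on exponents outside [s] than on [s], and positive off the last entry, so
   a large multiple of it outweighs [l1] there. *)
have [N [Nl Ns]] : exists N : R, (forall i, i != ord_max -> 0 < l1 0 i + N * l 0 i) /\
    forall u v, u \in s -> v \in msupp f -> v \notin s ->
      wt l1 u + N * wt l u < wt l1 v + N * wt l v.
  have large (b d : R) : 0 < d -> \forall N \near +oo%R, 0 < b + N * d.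
    move=> d0; apply: filterS (nbhs_pinfty_gt (num_real (- b / d))) => N.
    by rewrite ltr_pdivrMr // -subr_gt0 opprK addrC.
  apply: (@filter_ex _ +oo%R); apply: filterI.
    have : \forall N \near +oo%R, forall i, i \in enum 'I_n.+1 ->
        i != ord_max -> 0 < l1 0 i + N * l 0 i.
      apply: near_all_seq => i _; have [im|im] := boolP (i == ord_max).
        by apply: filterE.
      by apply: filterS (large (l1 0 i) _ (l0 i im)).
    by apply: filterS => N h i; apply: h; rewrite mem_enum.
  have : \forall N \near +oo%R, forall u, u \in s -> forall v, v \in msupp f ->
      v \notin s -> wt l1 u + N * wt l u < wt l1 v + N * wt l v.
    apply: near_all_seq => u us; apply: near_all_seq => v vf.
    have [vs|vs] := boolP (v \in s); first by apply: filterE.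
    have uv : 0 < wt l v - wt l u.
      move: us vs; rewrite !mem_filter vf andbT subr_gt0 => /andP[/allP umin uf].
      rewrite ltNge; apply: contra => vu; apply/allP => w wf.
      exact: le_trans vu (umin w wf).
    apply: filterS (large (wt l1 v - wt l1 u) _ uv) => N; lra.
  by apply: filterS => N h u v us; apply: h.
pose l2 := l1 + N *: l.
have wt2 (u : 'X_{1..n.+1}) : wt l2 u = wt l1 u + N * wt l u by rewrite dotDl dotZl.
have s_const u v : u \in s -> v \in s -> wt l u = wt l v.
  rewrite !mem_filter => /andP[/allP umin uf] /andP[/allP vmin vf].
  by apply/le_anti; rewrite umin // vmin.
(* As [l] is constant on [s], only [l1] discriminates among its exponents. *)
have l2_supp : face_support l2 = [seq u <- s | argmin_wt l1 s u].
  rewrite /s /face_support -filter_predI; apply: eq_in_filter => v vf /=.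
  have sE : argmin_wt l (msupp f) v = (v \in s) by rewrite mem_filter vf andbT.
  rewrite sE -/s; apply/allP/andP => [h|[/allP h vs] w wf].
    have vs : v \in s.
      have [u us _] := argmin_wt_exists l1 s0; apply: contraT => /(Ns u v us vf).
      rewrite -!wt2 ltNge h //.
      by move: us; rewrite mem_filter => /andP[].
    split=> //; apply/allP => w ws; have := h w.
    rewrite !wt2 (s_const v w vs ws) lerD2r; apply.
    by move: ws; rewrite mem_filter => /andP[].
  rewrite !wt2; have [ws|ws] := boolP (w \in s); last by apply/ltW/Ns.
  by rewrite (s_const v w vs ws) lerD2r h.
apply: (@face_degenerate l2 a f0 _ a0 _ nondeg).
  move=> i; rewrite !mxE; have [->|im] := eqVneq i ord_max; last exact: Nl.
  by rewrite l_last mulr0 addr0.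
apply/fiber_systemP; rewrite l2_supp; split.
  rewrite big_filter; apply: coef_lim => k.
  by have [_ _ /fiber_systemP[]] := xP k.
move=> i im; rewrite big_filter; apply: (coef_lim (fun w => f@_w * (w i)%:R)) => k.
by have [_ _ /fiber_systemP[_]] := xP k; apply.
Qed.

End DegenerateFiber.

Theorem proposition7p2 (R : realType) (n : nat) (f : {mpoly R[i][n.+1]})
    (f_neq0 : f != 0) (f_at0 : f.@[fun=> 0] = 0) (f_nondeg : newton_nondegenerate f) :
  finite_set [set c : R[i] | ~ newton_nondegenerate (shift_last c f)].
Proof.
pose supports := [set s | exists l : 'rV[R]_n.+1,
  [/\ l 0 ord_max = 0, forall i, i != ord_max -> 0 < l 0 i & s = face_support f l]].
have fin_supports : finite_set supports.
  (* Every support is a sublist of [msupp f], cut out by one of finitely many boolean masks. *)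
  pose masks := [set mask (val m) (msupp f) | m in [set: (size (msupp f)).-tuple bool]].
  apply: (@sub_finite_set _ _ masks); last exact/finite_image/finite_finset.
  move=> _ [l [_ _ ->]]; exists (map_tuple (argmin_wt l (msupp f)) (in_tuple (msupp f))) => //.
  by rewrite /= -filter_mask.
(* The exceptional values: 0, where the fiber misses the torus; the roots of some [last_coef], where
   an exponent may be lost; and the degenerate fibers of the finitely many supports. *)
apply: (@sub_finite_set _ _ ([set 0] `|`
  ((\bigcup_(w in [set` msupp f]) [set c | (last_coef f w).[c] = 0]) `|`
   \bigcup_(s in supports) degenerate_fibers f s))); last first.
  rewrite !finite_setU; split; first exact: finite_set1.
  split; apply: bigcup_finite.
  - exact: finite_seq.
  - by move=> w wf; apply/finite_roots/last_coef_neq0.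
  - exact: fin_supports.
  - by move=> _ [l [l_last l0 ->]]; apply: degenerate_fibers_finite.
move=> c /= deg; have [->|c0] := eqVneq c 0; first by left.
right.
have [[w wf wc]|c_gen] := pselect (exists2 w, w \in msupp f & (last_coef f w).[c] = 0).
  by left; exists w.
right; have [|l [l_last l0 lc]] := degenerate_shift_last c0 _ deg.
  by move=> w wf; apply/eqP => wc; apply: c_gen; exists w.
by exists (face_support f l) => //; exists l.
Qed.
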